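(* Given a finite set of distinct non-negative real price tags, any ordering of the set produced by the alternating max-to-min and min-to-max boundary-respecting construction (with initial left boundary value $1$ and initial right boundary value $0$) realizes the minimum voucher cost among all orderings of the set.
   Context: The voucher cost of a sequence $\vec v=(v_1,\dots,v_n)$ is $C_V(\vec v)=v_1+v_1v_2+v_2v_3+\cdots+v_{n-1}v_n$. The alternating max-to-min and min-to-max boundary-respecting construction fills positions $1,\dots,n$ with the given $n$ price tags from the outside inward; at each moment the unfilled positions form one contiguous interval, with a current left boundary value and a current right boundary value. Initially the left boundary value is $1$ and the right boundary value is $0$. First, place the greatest price tag $x$ at the rightmost position, and set the right boundary value to $x$. Then take the smallest price tag $y$ not yet placed and place it at the end of the unfilled interval adjacent to the larger of the two current boundary values (if there is a tie, either side may be chosen), and replace that boundary value by $y$. Then take the largest price tag not yet placed, place it at the end of the unfilled interval adjacent to the smaller of the two current boundary values (either side in case of a tie), and replace that boundary value by it. Continue alternating (smallest remaining next to the larger boundary, then largest remaining next to the smaller boundary) until all price tags are placed. For example, $\{0.2,2,4,5\}$ yields $(2,4,0.2,5)$. *)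

(* Defs.v *)
From mathcomp Require Import all_boot all_order all_algebra.
From mathcomp Require Import finmap.

Set Implicit Arguments.
Unset Strict Implicit.
Unset Printing Implicit Defensive.

Import Order.TTheory GRing.Theory Num.Theory.

Local Open Scope ring_scope.
Local Open Scope fset_scope.

Section Vouchers.
Variable R : realFieldType.
Implicit Types (S U : {fset R}) (v l r : seq R).

(* The entries v_1, ..., v_n are v`_0, ..., v`_(n-1). *)
Definition voucher_cost v : R :=
  v`_0 + \sum_(i < (size v).-1) v`_i * v`_i.+1.

Definition ordering_of S v : Prop := perm_eq v (enum_fset S).

Definition greatest_in U (x : R) : Prop :=
  x \in U /\ forall z, z \in U -> z <= x.

Definition smallest_in U (y : R) : Prop :=
  y \in U /\ forall z, z \in U -> y <= z.

(* [l] and [r] are the already filled leftmost and rightmost positions, in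
   reading order; the unfilled interval lies between them. *)
Definition left_boundary l : R := last 1 l.
Definition right_boundary r : R := head 0 r.

Inductive turn := PlaceSmallest | PlaceLargest.

(* [filling S t l r U]: starting from [S], the construction can reach the
   partial filling [l], [r] with the tags in [U] still to be placed, the next
   one according to [t].  When the two boundary values are equal, both the left
   and the right rule of the current turn apply. *)
Inductive filling S : turn -> seq R -> seq R -> {fset R} -> Prop :=
| FillFirst x :
    greatest_in S x ->
    filling S PlaceSmallest [::] [:: x] (S `\ x)
| FillSmallestLeft l r U y :
    filling S PlaceSmallest l r U -> smallest_in U y ->
    right_boundary r <= left_boundary l ->
    filling S PlaceLargest (rcons l y) r (U `\ y)
| FillSmallestRight l r U y :
    filling S PlaceSmallest l r U -> smallest_in U y ->
    left_boundary l <= right_boundary r ->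
    filling S PlaceLargest l (y :: r) (U `\ y)
| FillLargestLeft l r U x :
    filling S PlaceLargest l r U -> greatest_in U x ->
    left_boundary l <= right_boundary r ->
    filling S PlaceSmallest (rcons l x) r (U `\ x)
| FillLargestRight l r U x :
    filling S PlaceLargest l r U -> greatest_in U x ->
    right_boundary r <= left_boundary l ->
    filling S PlaceSmallest l (x :: r) (U `\ x).

Definition alternating_ordering S v : Prop :=
  exists t l r, filling S t l r fset0 /\ v = l ++ r.

Definition realizes_min_voucher_cost S v : Prop :=
  ordering_of S v /\
  forall w, ordering_of S w -> voucher_cost v <= voucher_cost w.

End Vouchers.

(* Main.v *)
Require Import Defs.
From mathcomp Require Import all_boot all_order all_algebra.
From mathcomp Require Import finmap.
From mathcomp Require Import ring.

(** With the boundary values 1 and 0 written at the two ends, the voucher cost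
    is the sum of the products of neighbours.  Reversing a block [d, ..., x]
    that stands between [a] and [c] changes the cost by [(a - c) * (x - d)].
    When the largest tag is to be placed, the smaller boundary value is at most
    every remaining tag; when the smallest tag is to be placed, the larger
    boundary value is at least every remaining tag.  Hence the reversal that
    brings the chosen tag next to the chosen boundary never increases the cost,
    so every partial filling extends to an ordering that is no worse than any
    given ordering. *)

Import Order.TTheory GRing.Theory Num.Theory.

Local Open Scope fset_scope.
Local Open Scope ring_scope.

(** The value [a] standing before [s] is a parameter, so that costs split along concatenations. The
    product with the final right boundary 0 vanishes and is omitted. *)
Fixpoint path_cost {R : realFieldType} (a : R) (s : seq R) : R :=
  if s is b :: s' then a * b + path_cost b s' else 0.

Lemma voucher_costE {R : realFieldType} (v : seq R) :
  voucher_cost v = path_cost 1 v.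
Proof.
have sumE (a : R) s : \sum_(i < size s) (a :: s)`_i * s`_i = path_cost a s.
  elim: s a => [|b s IHs] a; first by rewrite big_ord0.
  by rewrite big_ord_recl /= IHs.
rewrite /voucher_cost; case: v => [|a v]; first by rewrite big_ord0 addr0.
by rewrite [in RHS]/= mul1r -sumE.
Qed.

Lemma path_cost_cat {R : realFieldType} (a : R) (s t : seq R) :
  path_cost a (s ++ t) = path_cost a s + path_cost (last a s) t.
Proof. by elim: s a => [|b s IHs] a /=; rewrite ?add0r // IHs addrA. Qed.

(** Products of neighbours are symmetric, so the block [d :: s] costs the same read backwards. *)
Lemma path_cost_rev {R : realFieldType} (d : R) (s : seq R) :
  path_cost (last d s) (rev (belast d s)) = path_cost d s.
Proof.
elim: s d => [//|b s IHs] d /=.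
rewrite rev_cons -cats1 path_cost_cat IHs /= addr0 addrC; congr (_ + _).
by case: s {IHs} => [|c s] /=; rewrite ?rev_cons ?last_rcons mulrC.
Qed.

(* The default 0 of [head] makes this correct for empty [u] and empty [t]. *)
Lemma path_cost_rev_cat {R : realFieldType} (a : R) (u t : seq R) :
  path_cost a (rev u ++ t) =
  path_cost a (u ++ t) + (a - head 0 t) * (last 0 u - head 0 u).
Proof.
case: u => [|d s] /=; first by rewrite subrr mulr0 addr0.
have -> : rev (d :: s) = last d s :: rev (belast d s).
  by rewrite lastI rev_rcons.
rewrite /= !path_cost_cat path_cost_rev.
have -> : last (last d s) (rev (belast d s)) = d.
  by case: s => [|c s] //=; rewrite rev_cons last_rcons.
by case: t => [|c t] /=; ring.
Qed.

(** Reverse the prefix of [u] that ends in [x]. In the hypothesis, [d] stands for the first entry of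
    [u] and [c] for the entry just after [x], which is the right boundary value when [x] ends
    [u]. *)
Lemma move_left {R : realFieldType} {l r u : seq R} {x : R} :
    x \in u ->
    (forall c d : R, d \in u -> (c \in u) || (c == right_boundary r) ->
       (left_boundary l - c) * (x - d) <= 0) ->
  exists2 u', perm_eq (x :: u') u &
    path_cost 1 (rcons l x ++ u' ++ r) <= path_cost 1 (l ++ u ++ r).
Proof.
move=> /splitPr[p q] exch; exists (rev p ++ q).
  by rewrite -cat1s perm_catCA perm_cat // perm_rev.
have -> : rcons l x ++ (rev p ++ q) ++ r = l ++ rev (rcons p x) ++ (q ++ r).
  by rewrite rev_rcons cat_rcons /= -catA.
have -> : l ++ (p ++ x :: q) ++ r = l ++ rcons p x ++ (q ++ r).
  by rewrite cat_rcons -catA.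
rewrite !(path_cost_cat 1 l) path_cost_rev_cat lerD2l gerDl last_rcons.
apply: exch; first by case: p => [|b p] /=; rewrite !inE ?eqxx.
by case: q => [|b q] /=; rewrite ?eqxx ?orbT // mem_cat !inE eqxx !orbT.
Qed.

Lemma move_right {R : realFieldType} {l r u : seq R} {x : R} :
    x \in u ->
    (forall c d : R, d \in u -> (c \in u) || (c == left_boundary l) ->
       (right_boundary r - c) * (x - d) <= 0) ->
  exists2 u', perm_eq (x :: u') u &
    path_cost 1 (l ++ u' ++ (x :: r)) <= path_cost 1 (l ++ u ++ r).
Proof.
move=> /splitPr[p q] exch; exists (p ++ rev q).
  by rewrite -cat1s perm_catCA perm_cat //= perm_cons perm_rev.
have -> : l ++ (p ++ rev q) ++ (x :: r) = (l ++ p) ++ rev (x :: q) ++ r.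
  by rewrite rev_cons cat_rcons !catA.
have -> : l ++ (p ++ x :: q) ++ r = (l ++ p) ++ (x :: q) ++ r.
  by rewrite !catA.
rewrite !(path_cost_cat 1 (l ++ p)) path_cost_rev_cat lerD2l gerDl.
(* The reversed block now starts with [x] and is followed by [r], so both factors appear with the
   sign opposite to [exch]. *)
rewrite -mulrNN !opprB last_cat; apply: exch.
  by rewrite mem_cat [last 0 _]/= mem_last orbT.
case: (lastP p) => [|p' b]; first by rewrite eqxx orbT.
by rewrite last_rcons !mem_cat mem_rcons !inE eqxx.
Qed.

Lemma perm_enum_fsetD1 {R : realFieldType} {U : {fset R}} {x : R} :
  x \in U -> perm_eq (enum_fset U) (x :: enum_fset (U `\ x)).
Proof.
move=> xU; apply: uniq_perm; rewrite ?fset_uniq //=.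
  by rewrite fset_uniq andbT; apply/negP=> /fsetD1P[]; rewrite eqxx.
move=> z; rewrite inE; case: eqVneq => [->|zx] //=.
by apply/idP/idP => [zU|/fsetD1P[]//]; apply/fsetD1P.
Qed.

Definition boundary_extreme {R : realFieldType} (t : turn) (l r : seq R)
    (U : {fset R}) : Prop :=
  forall z, z \in U ->
  match t with
  | PlaceSmallest => z <= Num.max (left_boundary l) (right_boundary r)
  | PlaceLargest => Num.min (left_boundary l) (right_boundary r) <= z
  end.

(** Since [u] may depend on [w], no optimal ordering has to be chosen beforehand. *)
Definition extends_to_best {R : realFieldType} (S : {fset R}) (l r : seq R)
    (U : {fset R}) : Prop :=
  forall w, ordering_of S w -> exists2 u, perm_eq u (enum_fset U) &
    path_cost 1 (l ++ u ++ r) <= path_cost 1 w.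

Lemma extend_left {R : realFieldType} {S U : {fset R}} {l r : seq R} {x : R} :
    x \in U ->
    (forall c d : R, d \in U -> (c \in U) || (c == right_boundary r) ->
       (left_boundary l - c) * (x - d) <= 0) ->
  extends_to_best S l r U -> extends_to_best S (rcons l x) r (U `\ x).
Proof.
move=> xU exch best w /best[u uU le_w].
have [||u' u'u le_u] := @move_left R l r u x.
- by rewrite (perm_mem uU).
- by move=> c d; rewrite !(perm_mem uU); apply: exch.
exists u'; last exact: le_trans le_u le_w.
rewrite -(perm_cons x) (perm_trans u'u) // (perm_trans uU) //.
exact: perm_enum_fsetD1.
Qed.

Lemma extend_right {R : realFieldType} {S U : {fset R}} {l r : seq R} {x : R} :
    x \in U ->
    (forall c d : R, d \in U -> (c \in U) || (c == left_boundary l) ->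
       (right_boundary r - c) * (x - d) <= 0) ->
  extends_to_best S l r U -> extends_to_best S l (x :: r) (U `\ x).
Proof.
move=> xU exch best w /best[u uU le_w].
have [||u' u'u le_u] := @move_right R l r u x.
- by rewrite (perm_mem uU).
- by move=> c d; rewrite !(perm_mem uU); apply: exch.
exists u'; last exact: le_trans le_u le_w.
rewrite -(perm_cons x) (perm_trans u'u) // (perm_trans uU) //.
exact: perm_enum_fsetD1.
Qed.

Lemma filling_perm {R : realFieldType} {S U : {fset R}} {t : turn}
    {l r : seq R} :
  filling S t l r U -> perm_eq (l ++ enum_fset U ++ r) (enum_fset S).
Proof.
have left s s' V (z : R) : z \in V ->
    perm_eq (s ++ enum_fset V ++ s') (enum_fset S) ->
    perm_eq (rcons s z ++ enum_fset (V `\ z) ++ s') (enum_fset S).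
  move=> zV; apply: perm_trans; rewrite cat_rcons perm_cat2l.
  by rewrite -cat_cons perm_cat2r perm_sym perm_enum_fsetD1.
have right s s' V (z : R) : z \in V ->
    perm_eq (s ++ enum_fset V ++ s') (enum_fset S) ->
    perm_eq (s ++ enum_fset (V `\ z) ++ z :: s') (enum_fset S).
  move=> zV; apply: perm_trans; rewrite perm_cat2l -cat1s perm_catCA.
  by rewrite catA perm_cat2r perm_sym perm_enum_fsetD1.
elim=> [x [xS _]|{}l {}r {}U y _ IH [yU _] _|{}l {}r {}U y _ IH [yU _] _
       |{}l {}r {}U x _ IH [xU _] _|{}l {}r {}U x _ IH [xU _] _].
- by apply: right; rewrite ?cats0.
- exact: left.
- exact: right.
- exact: left.
- exact: right.
Qed.

(** The tag placed last was extreme among the tags then unplaced and is now a boundary value, so a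
    case analysis on the last placement suffices. *)
Lemma filling_boundary_extreme {R : realFieldType} {S U : {fset R}} {t : turn}
    {l r : seq R} :
  filling S t l r U -> boundary_extreme t l r U.
Proof.
case=> [x [_ ext]|{}l {}r {}U y _ [_ ext] _|{}l {}r {}U y _ [_ ext] _
       |{}l {}r {}U x _ [_ ext] _|{}l {}r {}U x _ [_ ext] _] z /fsetD1P[_ zU];
  by rewrite /left_boundary ?last_rcons /= ?le_max ?ge_min ext ?orbT.
Qed.

Lemma filling_extends_to_best {R : realFieldType} {S U : {fset R}} {t : turn}
    {l r : seq R} :
  (forall p : R, p \in S -> 0 <= p) ->
  filling S t l r U -> extends_to_best S l r U.
Proof.
move=> S_ge0; elim=> {t l r U}.
(* The first placement is a right placement into the empty filling, which [w] itself completes. *)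
- move=> x [xS ext]; apply: extend_right => //; last first.
    by move=> w wS; exists w; rewrite ?cats0.
  (* The right boundary is still 0 and [c] is a tag or 1, so nonnegativity of the tags gives the
     sign of the first factor. *)
  move=> c d dS cS; have c0 : 0 <= c.
    by case/orP: cS => [/S_ge0//|/eqP ->]; apply: ler01.
  by rewrite mulr_le0_ge0 // ?subr_le0 // subr_ge0 ext.
- move=> l r U y fill IH [yU ext] le_rl; apply: extend_left => // c d dU cU.
  rewrite mulr_ge0_le0 // ?subr_le0 ?ext // subr_ge0.
  (* Either [c] is a remaining tag, bounded by the larger boundary value, or it is the opposite
     boundary value, compared by [le_rl]. *)
  case/orP: cU => [/(filling_boundary_extreme fill)|/eqP -> //].
  by rewrite (max_idPl le_rl).
- move=> l r U y fill IH [yU ext] le_lr; apply: extend_right => // c d dU cU.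
  rewrite mulr_ge0_le0 // ?subr_le0 ?ext // subr_ge0.
  case/orP: cU => [/(filling_boundary_extreme fill)|/eqP -> //].
  by rewrite (max_idPr le_lr).
- move=> l r U x fill IH [xU ext] le_lr; apply: extend_left => // c d dU cU.
  rewrite mulr_le0_ge0 // ?subr_ge0 ?ext // subr_le0.
  case/orP: cU => [/(filling_boundary_extreme fill)|/eqP -> //].
  by rewrite (min_idPl le_lr).
- move=> l r U x fill IH [xU ext] le_rl; apply: extend_right => // c d dU cU.
  rewrite mulr_le0_ge0 // ?subr_ge0 ?ext // subr_le0.
  case/orP: cU => [/(filling_boundary_extreme fill)|/eqP -> //].
  by rewrite (min_idPr le_rl).
Qed.

Theorem theorem24 (R : realFieldType) (S : {fset R}) (v : seq R)
    (S_ge0 : forall p : R, p \in S -> 0 <= p) :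
  alternating_ordering S v -> realizes_min_voucher_cost S v.
Proof.
have enum0 : enum_fset (fset0 : {fset R}) = [::].
  by apply: size0nil; apply: cardfs0.
move=> [t [l [r [fill ->]]]]; split.
  by have := filling_perm fill; rewrite enum0.
(* With no tag left, [u] is empty and the completed ordering is [l ++ r] itself. *)
move=> w /(filling_extends_to_best S_ge0 fill)[u].
by rewrite enum0 => /perm_nilP -> /=; rewrite !voucher_costE.
Qed.
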